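(* Let $S$ be a finite nonempty set of states, $C=\{0,1,\dots,K\}$ ($K\ge 1$) a finite set of consequences, and let $\succsim$ be a binary relation on the set of all lotteries on $S\times C$. Then $\succsim$ satisfies axioms A1--A5 and A6* if and only if it is represented by a nonempty set $\mathcal{V}^{***}\subseteq\mathcal{V}^{++}$ of state-dependent expected utility functions that is the convex hull of a set of probability/utility pairs, where ''represented'' means that for all lotteries $\mathbf{X},\mathbf{Y}$, $$\mathbf{X}\succsim\mathbf{Y}\iff U_v(\mathbf{X})-U_v(\mathbf{Y})\ge 0\ \text{ for all } v\in\mathcal{V}^{***}.$$ In particular, if $\succsim$ satisfies A1--A5 and A6* and $\{\mathbf{X}_n\succsim\mathbf{Y}_n\}$ is a basis for $\succsim$ under A1--A5 and A6*, then $\mathcal{V}^{***}$ is the convex hull of the set of probability/utility pairs $v\in\mathcal{V}^{++}$ that satisfy $U_v(\mathbf{X}_n)\ge U_v(\mathbf{Y}_n)$ for all $n$ (i.e. this convex hull is nonempty and represents $\succsim$).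
   Context: A (horse) lottery is a function $\mathbf{X}:S\times C\to\mathbb{R}$ with $X(s,c)\ge 0$ for all $s,c$ and $\sum_{c}X(s,c)=1$ for every $s\in S$. It is constant if $X(s,c)=X(s',c)$ for all $s,s',c$. For $c\in C$, $\mathbf{H}_c$ is the lottery with $\mathbf{H}_c(s,c')=1$ if $c'=c$ and $0$ otherwise (for every $s$). Consequences $0$ and $1$ play the roles of worst and best. For $p\in[0,1]$, $\mathbf{H}_p=p\mathbf{H}_1+(1-p)\mathbf{H}_0$ (consistent with the notation $\mathbf{H}_0,\mathbf{H}_1$). $\mathbf{X}\succ\mathbf{Y}$ means $\mathbf{X}\succsim\mathbf{Y}$ and not $\mathbf{Y}\succsim\mathbf{X}$; $\mathbf{X}\precsim\mathbf{Y}$ means $\mathbf{Y}\succsim\mathbf{X}$. An event is a subset $\mathbf{E}$ of $S$, identified with its indicator function on $S\times C$ ($E(s,c)=1$ if $s\in\mathbf{E}$, else $0$); products such as $\mathbf{E}\mathbf{X}$ are pointwise, and $\mathbf{1}$ is the constant function 1. $\mathbf{H}_{\mathbf{E}}=\mathbf{E}\mathbf{H}_1+(\mathbf{1}-\mathbf{E})\mathbf{H}_0$. The notation $\alpha\mathbf{E}\mathbf{X}+(1-\alpha)\mathbf{X}'\succsim\alpha\mathbf{E}\mathbf{Y}+(1-\alpha)\mathbf{Y}'$ is shorthand for: $\alpha(\mathbf{E}\mathbf{X}+(\mathbf{1}-\mathbf{E})\mathbf{Z})+(1-\alpha)\mathbf{X}'\succsim\alpha(\mathbf{E}\mathbf{Y}+(\mathbf{1}-\mathbf{E})\mathbf{Z})+(1-\alpha)\mathbf{Y}'$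 for all lotteries $\mathbf{Z}$. Axioms (on a relation $\succsim$ on lotteries): - A1 (quasi order): $\succsim$ is transitive and reflexive. - A2 (mixture-independence): for all lotteries $\mathbf{X},\mathbf{Y},\mathbf{Z}$ and all $\alpha\in(0,1)$: $\mathbf{X}\succsim\mathbf{Y}\iff\alpha\mathbf{X}+(1-\alpha)\mathbf{Z}\succsim\alpha\mathbf{Y}+(1-\alpha)\mathbf{Z}$. - A3 (continuity): if $\{\mathbf{X}_n\}$, $\{\mathbf{Y}_n\}$ are convergent sequences of lotteries with $\mathbf{X}_n\succsim\mathbf{Y}_n$ for all $n$, then $\lim\mathbf{X}_n\succsim\lim\mathbf{Y}_n$. - A4 (best and worst): for all $c>1$, $\mathbf{H}_1\succsim\mathbf{H}_c\succsim\mathbf{H}_0$. - A5 (coherence/nontriviality): $\mathbf{H}_1\succ\mathbf{H}_0$, i.e. $\mathbf{H}_1\succsim\mathbf{H}_0$ and not $\mathbf{H}_0\succsim\mathbf{H}_1$. - A6* (strong state-independence): if $\mathbf{X},\mathbf{Y}$ are constant lotteries, $\mathbf{X}',\mathbf{Y}'$ are lotteries with $\mathbf{X}'\succsim\mathbf{Y}'$, and $\mathbf{E},\mathbf{F}$ are events with $\mathbf{H}_{\mathbf{E}}\succsim\mathbf{H}_p$ and $\mathbf{H}_{\mathbf{F}}\precsim\mathbf{H}_q$ where $p>0$, then for $\alpha\in[0,1]$ $$\alpha\mathbf{E}\mathbf{X}+(1-\alpha)\mathbf{X}'\succsim\alpha\mathbf{E}\mathbf{Y}+(1-\alpha)\mathbf{Y}'\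 \Longrightarrow\ \beta\mathbf{F}\mathbf{X}+(1-\beta)\mathbf{X}'\succsim\beta\mathbf{F}\mathbf{Y}+(1-\beta)\mathbf{Y}'$$ for $\beta=1$ if $\alpha=1$, and otherwise for all $\beta\in[0,1)$ such that $\frac{\beta}{1-\beta}\le\frac{\alpha}{1-\alpha}\cdot\frac{p}{q}$. (Here $p,q\in[0,1]$; one may take $q>0$, so that $p/q$ is defined.) A collection of preferences $\{\mathbf{X}_n\succsim\mathbf{Y}_n\}$ (a subset, possibly infinite, of the relation $\succsim$) is a basis for $\succsim$ under an axiom system if every preference $\mathbf{X}\succsim\mathbf{Y}$ can be deduced from $\{\mathbf{X}_n\succsim\mathbf{Y}_n\}$ by direct application of those axioms; that is, $\succsim$ is the smallest relation containing the collection and satisfying the axioms. A state-dependent expected utility (s.d.e.u.) function is a function $v:S\times C\to\mathbb{R}$; it induces $U_v(\mathbf{X})=\sum_{s\in S,c\in C}X(s,c)v(s,c)$. It is a probability/utility pair if $v(s,c)=p(s)u(c)$ for all $s,c$, for some probability distribution $p:S\to[0,1]$ and some function $u:C\to\mathbb{R}$. The normalized set is $$\mathcal{V}^{++}=\Big\{v:\ 0=v(s,0)\le v(s,c)\le v(s,1)\le 1\ \ \forall s\in S,\ c\ge 2;\ \ \sum_{s\in S}v(s,1)=1\Big\}.$$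
   Formalization: The condition that H_1 ≽ H_F for every event F is added to A1–A5 and A6* (also in the notion of basis); without it the ''only if'' and basis claims fail, e.g. for two states, K=1, and the relation represented by v(·,0)=0 with v(·,1)=(2,−1) and (−1,2). *)

(* Defs.v *)
From HB Require Import structures.
From mathcomp Require Import all_boot all_order all_algebra.
From mathcomp Require Import all_classical all_reals all_analysis.
Import Order.TTheory GRing.Theory Num.Theory.
Import numFieldNormedType.Exports.

Set Implicit Arguments.
Unset Strict Implicit.
Unset Printing Implicit Defensive.

Local Open Scope classical_set_scope.
Local Open Scope ring_scope.

(* MathComp-Analysis, over an arbitrary realType R. The consequences
   {0, ..., K} are 'I_K.+1; everything is meant for 0 < K, so that
   [inord 1] really is the consequence 1. *)
Definition worst {K : nat} : 'I_K.+1 := ord0.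
Definition best {K : nat} : 'I_K.+1 := inord 1.

(* Real functions on S x C. Lotteries and state-dependent expected utility
   functions are both of this type. *)
Definition act (R : realType) (S : finType) (K : nat) := S -> 'I_K.+1 -> R.

(* A relation on lotteries. Its values outside [lottery] are irrelevant: every
   definition below only looks at it on lotteries. *)
Definition preference (R : realType) (S : finType) (K : nat) :=
  act R S K -> act R S K -> Prop.

Section Lotteries.
Context {R : realType} {S : finType} {K : nat}.
Implicit Types (X Y Z v : act R S K) (E F : {set S}).

Definition lottery X :=
  (forall s c, 0 <= X s c) /\ (forall s, \sum_c X s c = 1).

Definition constant_act X := forall s s' c, X s c = X s' c.

Definition sure (c : 'I_K.+1) : act R S K := fun _ c' => (c' == c)%:R.

Definition mix (a : R) X Y : act R S K :=
  fun s c => a * X s c + (1 - a) * Y s c.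

Definition ind E (s : S) : R := (s \in E)%:R.

(* E X + (1 - E) Z *)
Definition onev E X Z : act R S K :=
  fun s c => ind E s * X s c + (1 - ind E s) * Z s c.

Definition Hprob (p : R) : act R S K := mix p (sure best) (sure worst).

Definition Hevent E : act R S K := onev E (sure best) (sure worst).

Definition expU v X : R := \sum_s \sum_c X s c * v s c.

End Lotteries.

Section Preferences.
Context {R : realType} {S : finType} {K : nat}.
Implicit Types (pref : preference R S K) (X Y Z : act R S K).

Definition A1 pref :=
  (forall X, lottery X -> pref X X) /\
  (forall X Y Z, lottery X -> lottery Y -> lottery Z ->
     pref X Y -> pref Y Z -> pref X Z).

Definition A2 pref :=
  forall X Y Z (a : R), lottery X -> lottery Y -> lottery Z -> 0 < a < 1 ->
    (pref X Y <-> pref (mix a X Z) (mix a Y Z)).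

(* Convergence of lotteries is pointwise, S x C being finite; the limits are
   automatically lotteries. *)
Definition A3 pref :=
  forall (Xn Yn : nat -> act R S K) X Y,
    (forall n, lottery (Xn n)) -> (forall n, lottery (Yn n)) ->
    (forall s c, (fun n => Xn n s c) @ \oo --> X s c) ->
    (forall s c, (fun n => Yn n s c) @ \oo --> Y s c) ->
    (forall n, pref (Xn n) (Yn n)) -> pref X Y.

Definition A4 pref :=
  forall c : 'I_K.+1, (1 < c)%N ->
    pref (sure best) (sure c) /\ pref (sure c) (sure worst).

Definition A5 pref :=
  pref (sure best) (sure worst) /\ ~ pref (sure worst) (sure best).

(* [a E X + (1 - a) X' >~ a E Y + (1 - a) Y'], where E X and E Y are completed
   outside E by a common lottery Z, for all Z. *)
Definition called_off pref (a : R) (E : {set S}) X X' Y Y' :=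
  forall Z, lottery Z ->
    pref (mix a (onev E X Z) X') (mix a (onev E Y Z) Y').

Definition A6star pref :=
  forall X Y X' Y' (E F : {set S}) (p q a b : R),
    lottery X -> lottery Y -> lottery X' -> lottery Y' ->
    constant_act X -> constant_act Y -> pref X' Y' ->
    0 < p <= 1 -> 0 < q <= 1 ->
    pref (Hevent E) (Hprob p) -> pref (Hprob q) (Hevent F) ->
    0 <= a <= 1 ->
    (a = 1 /\ b = 1) \/
      (a < 1 /\ 0 <= b < 1 /\ b / (1 - b) <= a / (1 - a) * (p / q)) ->
    called_off pref a E X X' Y Y' -> called_off pref b F X X' Y Y'.

Definition axioms pref :=
  [/\ A1 pref, A2 pref, A3 pref & [/\ A4 pref, A5 pref & A6star pref]].

(* Consequence 1 is at least as good as 0 in every event: H_1 >~ H_F, i.e. each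
   event admits the trivial upper bound q = 1 in A6star. This is tacit in
   A6star (an event without any upper bound q is not constrained by it) and
   holds for every relation represented within [Vpp], but it does not follow
   from [axioms]: for S = {s1, s2} and K = 1, the relation represented by the
   two functions v, v' with v(_,0) = v'(_,0) = 0, v(_,1) = (2, -1) and
   v'(_,1) = (-1, 2) satisfies [axioms] but not H_1 >~ H_{s1}. *)
Definition best_on_events pref :=
  forall F : {set S}, pref (sure best) (Hevent F).

(* [B X Y] means that X >~ Y is one of the preferences of the collection;
   [Ax] is the axiom system. *)
Definition is_basis (Ax : preference R S K -> Prop) (B : preference R S K)
    pref :=
  (forall X Y, B X Y -> [/\ lottery X, lottery Y & pref X Y]) /\
  (forall Q : preference R S K, Ax Q -> (forall X Y, B X Y -> Q X Y) ->
     forall X Y, lottery X -> lottery Y -> pref X Y -> Q X Y).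

End Preferences.

Section Representation.
Context {R : realType} {S : finType} {K : nat}.
Implicit Types (v : act R S K) (V : set (act R S K)) (pref : preference R S K).

Definition prob_utility v :=
  exists (p : S -> R) (u : 'I_K.+1 -> R),
    [/\ forall s, 0 <= p s <= 1, \sum_s p s = 1 &
        forall s c, v s c = p s * u c].

(* The middle condition ranges over all c; it adds nothing for c = 0 and, for
   c = 1, only 0 <= v(s,1), which must also hold when K = 1. *)
Definition Vpp : set (act R S K) := [set v |
  [/\ forall s, v s worst = 0,
      forall s c, 0 <= v s c <= v s best,
      forall s, v s best <= 1 &
      \sum_s v s best = 1]].

Definition conv_hull V : set (act R S K) := [set v |
  exists n (w : 'I_n -> R) (f : 'I_n -> act R S K),
    [/\ forall i, 0 <= w i, \sum_i w i = 1, forall i, V (f i) &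
        forall s c, v s c = \sum_i w i * f i s c]].

Definition represents V pref :=
  forall X Y : act R S K, lottery X -> lottery Y ->
    (pref X Y <-> forall v, V v -> expU v X - expU v Y >= 0).

End Representation.

(* Main.v *)
(* The differences t (X - Y) with t > 0 and X >~ Y form a closed convex cone
   (A1-A3), so a preference that fails is separated from it by a linear
   functional, which A4-A5 and A6* allow to be normalized into Vpp. It
   remains to choose this functional v among the probability/utility pairs.
   By Straszewicz's farthest-point argument v can be taken exposed in the
   normalized dual of the cone: some W in the cone vanishes at v and nowhere
   else. Let d be a constant difference with positive expected utility under
   v. Then d + l W belongs to the cone for large l, and by A6* so does F d +
   l W for every event F; evaluating at v shows that F d has nonnegative
   expected utility. So every v(s, _) ranks constant differences as sum_s
   v(s, _) does, i.e. is a multiple of it.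

   For a basis B, the relation represented by the pairs that respect B
   satisfies the axioms and contains B, so all these pairs are monotone for
   >~. *)
Require Import Defs.
From mathcomp Require Import all_boot all_order all_algebra.
From mathcomp Require Import all_classical all_reals all_analysis.
From mathcomp Require Import ring lra.
Import Order.TTheory GRing.Theory Num.Theory.
Import numFieldNormedType.Exports.

Set Implicit Arguments.
Unset Strict Implicit.
Unset Printing Implicit Defensive.

Local Open Scope classical_set_scope.
Local Open Scope ring_scope.

(** * Inequalities in the limit and a first-order condition *)

Lemma cvgn_le (R : realType) (u : nat -> R) (l M : R) :
  u @ \oo --> l -> (forall n, u n <= M) -> l <= M.
Proof.
move=> ul uM; apply: (@closed_cvg _ _ _ _ u (fun x => x <= M)) ul.
- exact: closed_le.
- exact: nearW.
Qed.

Lemma cvgn_ge (R : realType) (u : nat -> R) (l M : R) :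
  u @ \oo --> l -> (forall n, M <= u n) -> M <= l.
Proof.
move=> ul uM; apply: (@closed_cvg _ _ _ _ u (fun x => M <= x)) ul.
- exact: closed_ge.
- exact: nearW.
Qed.

(** The first-order condition behind projection arguments: with a negative slope [a] the quadratic
    is negative for small [t]. The witness satisfies t (b - a + 1) = - a, so that a + t b = - t (1 -
    a) < 0. *)
Lemma quad_ge0 (R : realType) (a b : R) : 0 <= b ->
  (forall t, 0 < t <= 1 -> 0 <= t * a + t ^+ 2 * b) -> 0 <= a.
Proof.
move=> b0 H; rewrite leNgt; apply/negP => a0.
have D0 : 0 < b - a + 1 by lra.
pose t := - a / (b - a + 1).
have t0 : 0 < t by rewrite /t divr_gt0// oppr_gt0.
have t1 : t <= 1 by rewrite /t ler_pdivrMr//; lra.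
have := H t; rewrite t0 t1 => /(_ isT).
rewrite expr2 -mulrA -mulrDr pmulr_rge0// => h.
have tD : t * (b - a + 1) = - a by rewrite /t mulfVK// gt_eqF.
nra.
Qed.

(** * Euclidean geometry of acts: projection, separation, farthest points *)

Section Euclidean.
Context {R : realType} {S : finType} {K : nat}.
Implicit Types (X Y Z v w : act R S K) (A C : set (act R S K)).

(** Serves for all vector operations: [lin 1 X (-1) Y] is a difference, [lin a X 0 X] a scalar
    multiple. *)
Definition lin (a : R) X (b : R) Y : act R S K :=
  fun s c => a * X s c + b * Y s c.

Definition seq_closed A :=
  forall (u : nat -> act R S K) X, (forall n, A (u n)) ->
    (forall s c, (fun n => u n s c) @ \oo --> X s c) -> A X.

(** Acts and utility functions share one type, on which [expU] is the Euclidean inner product and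
    [expU v v] the squared norm. *)
Lemma expUC v X : expU v X = expU X v.
Proof. by apply: eq_bigr => s _; apply: eq_bigr => c _; rewrite mulrC. Qed.

Lemma expU_linr v a X b Y : expU v (lin a X b Y) = a * expU v X + b * expU v Y.
Proof.
rewrite /expU !mulr_sumr -big_split/=; apply: eq_bigr => s _.
rewrite !mulr_sumr -big_split/=; apply: eq_bigr => c _; rewrite /lin; ring.
Qed.

Lemma expU_linl v w a b X :
  expU (lin a v b w) X = a * expU v X + b * expU w X.
Proof. by rewrite !(expUC _ X) expU_linr. Qed.

Lemma expU_mix v a X Y :
  expU v (mix a X Y) = a * expU v X + (1 - a) * expU v Y.
Proof. exact: expU_linr. Qed.

Lemma expU_sqr_ge0 v : 0 <= expU v v.
Proof.
by apply: sumr_ge0 => s _; apply: sumr_ge0 => c _; rewrite -expr2 sqr_ge0.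
Qed.

Lemma sqr_le_expU v s c : v s c ^+ 2 <= expU v v.
Proof.
rewrite /expU (bigD1 s)//= (bigD1 c)//= expr2 -addrA lerDl addr_ge0//.
  by apply: sumr_ge0 => c' _; rewrite -expr2 sqr_ge0.
by apply: sumr_ge0 => s' _; apply: sumr_ge0 => c' _; rewrite -expr2 sqr_ge0.
Qed.

Lemma expU_sqr_eq0 v : expU v v = 0 -> forall s c, v s c = 0.
Proof.
move=> v0 s c; have := sqr_le_expU v s c; rewrite v0 => v2.
by apply/eqP; rewrite -sqrf_eq0 eq_le v2 sqr_ge0.
Qed.

Definition sqdist X Y := expU (lin 1 X (-1) Y) (lin 1 X (-1) Y).

Lemma sqdistE X Y : sqdist X Y = expU X X - 2 * expU X Y + expU Y Y.
Proof. rewrite /sqdist expU_linl !expU_linr (expUC Y X); ring. Qed.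

Lemma cvg_expU (T : Type) (F : set_system T) {FF : Filter F}
    (u w : T -> act R S K) X Y :
  (forall s c, (fun n => u n s c) @ F --> X s c) ->
  (forall s c, (fun n => w n s c) @ F --> Y s c) ->
  (fun n => expU (u n) (w n)) @ F --> expU X Y.
Proof.
move=> uX wY; apply: cvg_big => [|s _]; first exact: add_continuous.
apply: cvg_big => [|c _]; first exact: add_continuous.
by apply: cvgM.
Qed.

Lemma cvg_lin (T : Type) (F : set_system T) {FF : Filter F}
    (u w : T -> act R S K) X Y (a b : R) :
  (forall s c, (fun n => u n s c) @ F --> X s c) ->
  (forall s c, (fun n => w n s c) @ F --> Y s c) ->
  forall s c, (fun n => lin a (u n) b (w n) s c) @ F --> lin a X b Y s c.
Proof.
move=> uX wY s c; apply: cvgD.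
- by apply: cvgM => //; exact: cvg_cst.
- by apply: cvgM => //; exact: cvg_cst.
Qed.

(** Compactness is obtained by transport to row vectors. The factor [k] covers both nearest points
    (k = 1) and farthest points (k = -1). *)
Lemma exists_min_sqdist A (M k : R) Y :
  A !=set0 -> (forall X, A X -> forall s c, `|X s c| <= M) -> seq_closed A ->
  exists2 X, A X & forall Z, A Z -> k * sqdist X Y <= k * sqdist Z Y.
Proof.
move=> [X0 AX0] AM Acl.
pose phi (w : 'rV[R]_(#|{: S * 'I_K.+1}|)) : act R S K :=
  fun s c => w ord0 (enum_rank (s, c)).
pose psi X : 'rV[R]_(#|{: S * 'I_K.+1}|) :=
  \row_j X (enum_val j).1 (enum_val j).2.
have psiK X : phi (psi X) = X.
  by apply/funext => s; apply/funext => c; rewrite /phi mxE enum_rankK.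
have phiE (w : 'rV[R]_(#|{: S * 'I_K.+1}|)) j :
    w ord0 j = phi w (enum_val j).1 (enum_val j).2.
  by rewrite /phi -surjective_pairing enum_valK.
pose B := [set w | A (phi w)].
have Bcl : closed B.
  move=> w clw.
  (* A point of the closure is the limit of points of [B] chosen in shrinking balls, to which
     [seq_closed] applies. *)
  have near_w (n : nat) : exists z, B z /\ ball w (n.+1%:R^-1) z.
    have n0 : 0 < n.+1%:R^-1 :> R by rewrite invr_gt0 ltr0n.
    by have [z [Bz wz]] := clw _ (nbhsx_ballx w _ n0); exists z.
  have [z Hz] := choice near_w.
  apply: (Acl (fun n => phi (z n))) => [n|s c]; first exact: (Hz n).1.
  apply/cvgrPdist_lt => e e0.
  near=> n.
  have [_ /(_ ord0 (enum_rank (s, c)))] := (Hz n).2.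
  rewrite -ball_normE/= => /lt_trans; apply.
  by near: n; exact: near_infty_natSinv_lt (PosNum e0).
have Bcpt : compact B.
  apply: (subclosed_compact Bcl (@rV_compact _ _ (fun=> `[-M, M]%classic) _)).
    by move=> _; exact: segment_compact.
  move=> w Bw i /=; rewrite in_itv/= -ler_norml phiE; exact: AM.
pose h (w : 'rV[R]_(#|{: S * 'I_K.+1}|)) := k * sqdist (phi w) Y.
have hcont : {within B, continuous h}.
  apply: continuous_subspaceT => w;
  have cphi s c : (fun m => phi m s c) @ w --> phi w s c.
    exact: coord_continuous.
  have cdist : (fun m => sqdist (phi m) Y) @ w --> sqdist (phi w) Y.
    apply: (@cvg_expU _ (nbhs w)) => s c;
    by apply: (@cvg_lin _ (nbhs w)) => // s' c'; exact: cvg_cst.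
  exact: cvgM (cvg_cst k) cdist.
have B0 : B !=set0 by exists (psi X0); rewrite /B/= psiK.
have [w] := compact_EVT_min B0 Bcpt hcont.
rewrite inE => Bw wmin; exists (phi w) => // Z AZ.
by rewrite -(psiK Z); apply: wmin; rewrite inE /B/= psiK.
Unshelve. all: by end_near. Qed.


Definition convex_cone C := C !=set0 /\
  forall a b X Y, 0 <= a -> 0 <= b -> C X -> C Y -> C (lin a X b Y).

(** Let X be the point of C nearest to Y and v = X - Y. Moving X to X + t Z shows that v is
    nonnegative on C; shrinking X to (1 - t) X shows that v is at most 0 at X. Hence the value of v
    at Y is at most - |v|^2 < 0. *)
Lemma cone_separation C Y : convex_cone C -> seq_closed C -> ~ C Y ->
  exists2 v, (forall X, C X -> 0 <= expU v X) & expU v Y < 0.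
Proof.
move=> [[X0 CX0] Clin] Ccl nCY.
pose O := lin 0 X0 0 X0.
have CO : C O by exact: Clin.
have OE X : expU X O = 0 by rewrite expU_linr; ring.
have dO : sqdist O Y = expU Y Y.
  by rewrite sqdistE OE (expUC O) OE; ring.
(* Keeping only the points of the cone no farther from Y than the origin gives a bounded nonempty
   set with the same nearest point. *)
pose A := [set X | C X /\ sqdist X Y <= expU Y Y].
have [||| X [CX XY] Xmin] := @exists_min_sqdist A (1 + 4 * expU Y Y) 1 Y.
- by exists O; split => //; rewrite dO.
(* Entrywise x^2 <= 4 |Y|^2, and |x| <= 1 + x^2 avoids a square root. *)
- move=> X [_ XY] s c.
  have := sqr_le_expU (lin 1 X (-1) Y) s c; have := sqr_le_expU Y s c.
  rewrite /sqdist in XY => YY /le_trans/(_ XY); rewrite /lin => XYsc.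
  have := sqr_ge0 (X s c - 2 * Y s c); have := sqr_ge0 (X s c - 1).
  by have := sqr_ge0 (X s c + 1); rewrite ler_norml => *; apply/andP; split; nra.
- move=> u X Au uX; split; first exact: Ccl (fun n => (Au n).1) uX.
  have cv : (fun n => sqdist (u n) Y) @ \oo --> sqdist X Y.
    by apply: cvg_expU => s c; apply: cvg_lin => // s' c'; exact: cvg_cst.
  by apply: cvgn_le cv _ => n; exact: (Au n).2.
have {}Xmin Z : C Z -> sqdist X Y <= sqdist Z Y.
  move=> CZ; have [ZY|/ltW ZY] := leP (sqdist Z Y) (expU Y Y).
    by have := Xmin Z (conj CZ ZY); rewrite !mul1r.
  exact: le_trans ZY.
exists (lin 1 X (-1) Y) => [Z CZ|].
  apply: (quad_ge0 (b := expU Z Z / 2)); first by rewrite divr_ge0// expU_sqr_ge0.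
  move=> t /andP[t0 _].
  have := Xmin (lin 1 X t Z) (Clin _ _ _ _ ler01 (ltW t0) CX CZ).
  rewrite !sqdistE !expU_linl !expU_linr (expUC Z X) (expUC Y Z); lra.
have XX : expU (lin 1 X (-1) Y) X <= 0.
  rewrite -oppr_ge0; apply: (quad_ge0 (b := expU X X / 2)).
    by rewrite divr_ge0// expU_sqr_ge0.
  move=> t /andP[t0 t1].
  have := Xmin (lin (1 - t) X 0 X) (Clin _ _ _ _ _ (lexx _) CX CX).
  rewrite subr_ge0 => /(_ t1).
  rewrite !sqdistE !expU_linl !expU_linr (expUC Y X); lra.
have : 0 < expU (lin 1 X (-1) Y) (lin 1 X (-1) Y).
  rewrite lt_neqAle expU_sqr_ge0 andbT eq_sym; apply/eqP => /expU_sqr_eq0 XY0.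
  apply: nCY; suff -> : Y = X by [].
  apply/funext => s; apply/funext => c; have := XY0 s c; rewrite /lin; lra.
rewrite [X in 0 < X -> _]expU_linr; lra.
Qed.

(** Expand the square of w - Y = (w - v) + (v - Y): the functional v - Y is maximal on A at v, with
    a quadratic gap elsewhere. *)
Lemma farthest_exposed A Y v : (forall w, A w -> sqdist w Y <= sqdist v Y) ->
  forall w, A w ->
    sqdist w v / 2 <= expU v (lin 1 v (-1) Y) - expU w (lin 1 v (-1) Y).
Proof.
move=> vmax w Aw; have := vmax _ Aw.
rewrite !sqdistE !expU_linr (expUC w v); lra.
Qed.

(* Straszewicz's argument: the point of A farthest from N Y is exposed, and for
   large N it still satisfies expU v Y < 0. *)
Lemma exists_exposed A (M : R) Y v0 :
  (forall v, A v -> forall s c, `|v s c| <= M) -> seq_closed A -> A v0 ->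
  expU v0 Y < 0 ->
  exists v w, [/\ A v, expU v Y < 0 &
    forall v', A v' -> sqdist v' v <= expU v w - expU v' w].
Proof.
move=> AM Acl Av0 v0Y.
pose B : R := 1 + \sum_(s : S) \sum_(c < K.+1) M ^+ 2.
have vB v : A v -> expU v v <= B.
  move=> Av; apply: (@le_trans _ _ (\sum_(s : S) \sum_(c < K.+1) M ^+ 2)).
    apply: ler_sum => s _; apply: ler_sum => c _.
    rewrite -expr2 -real_normK ?num_real//.
    by rewrite ler_sqr ?nnegrE ?AM//; exact: le_trans (AM _ Av s c).
  by rewrite lerDr.
have B0 : 0 < B.
  rewrite ltr_pwDl// sumr_ge0// => s _; rewrite sumr_ge0// => c _; exact: sqr_ge0.
(* Comparing v with v0 gives 2 N <v, Y> <= |v|^2 - |v0|^2 + 2 N <v0, Y> <= B - 2 B < 0. *)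
pose N := B / - expU v0 Y.
have NY : N * expU v0 Y = - B.
  by rewrite /N invrN mulrN mulNr mulfVK// lt_eqF.
have N0 : 0 < N by rewrite /N divr_gt0// oppr_gt0.
have [v Av vmin] :=
  exists_min_sqdist (-1) (lin N Y 0 Y) (ex_intro _ v0 Av0) AM Acl.
have {}vmin w : A w -> sqdist w (lin N Y 0 Y) <= sqdist v (lin N Y 0 Y).
  by move=> /vmin; rewrite !mulN1r lerN2.
(* The factor 2 absorbs the one half of [farthest_exposed]. *)
exists v, (lin 2 (lin 1 v (-1) (lin N Y 0 Y)) 0 Y).
split=> // [|w /(farthest_exposed vmin)].
  have := vmin _ Av0; have := vB _ Av; have := expU_sqr_ge0 v0.
  rewrite !sqdistE !expU_linr => *; rewrite -(pmulr_rlt0 _ N0); lra.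
rewrite !(expU_linr _ 2); lra.
Qed.

End Euclidean.

(** * Lotteries, their differences, and restriction to events *)

Section Lotteries.
Context {R : realType} {S : finType} {K : nat}.
Implicit Types (X Y Z v : act R S K) (E F : {set S}).

Lemma actP X Y : (forall s c, X s c = Y s c) -> X = Y.
Proof. by move=> XY; apply/funext => s; apply/funext => c. Qed.

Lemma mix_lottery a X Y : 0 <= a <= 1 -> lottery X -> lottery Y ->
  lottery (mix a X Y).
Proof.
move=> /andP[a0 a1] [X0 X1] [Y0 Y1]; split=> [s c|s].
  by rewrite /mix addr_ge0// mulr_ge0// subr_ge0.
by rewrite big_split/= -!mulr_sumr X1 Y1; ring.
Qed.

Lemma onev_lottery E X Y : lottery X -> lottery Y -> lottery (onev E X Y).
Proof.
move=> lX lY; split=> [s c|s]; rewrite /onev /ind; case: (s \in E) => /=.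
- by rewrite mul1r subrr mul0r addr0; exact: lX.1.
- by rewrite mul0r add0r subr0 mul1r; exact: lY.1.
- by under eq_bigr do rewrite mul1r subrr mul0r addr0; exact: lX.2.
- by under eq_bigr do rewrite mul0r add0r subr0 mul1r; exact: lY.2.
Qed.

Lemma sum_delta (f : 'I_K.+1 -> R) c :
  \sum_c' (c' == c)%:R * f c' = f c.
Proof.
rewrite (bigD1 c)//= eqxx mul1r big1 ?addr0// => c' /negbTE ->.
by rewrite mul0r.
Qed.

Lemma sure_lottery c : lottery (@sure R S K c).
Proof.
split=> [s c'|s]; first exact: ler0n.
by rewrite -(sum_delta (fun=> 1) c); apply: eq_bigr => c' _; rewrite mulr1.
Qed.

Lemma expU_sure v c : expU v (sure c) = \sum_s v s c.
Proof. by apply: eq_bigr => s _; exact: sum_delta. Qed.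

Lemma Hevent_lottery E : lottery (@Hevent R S K E).
Proof. by apply: onev_lottery; exact: sure_lottery. Qed.

(** The linear space spanned by differences of lotteries. *)
Definition balanced Z := forall s, \sum_c Z s c = 0.

Lemma balanced_lin a X b Y : balanced X -> balanced Y -> balanced (lin a X b Y).
Proof.
by move=> X0 Y0 s; rewrite big_split/= -!mulr_sumr X0 Y0 !mulr0 addr0.
Qed.

Lemma balanced_sub a X Y : lottery X -> lottery Y -> balanced (lin a X (- a) Y).
Proof.
by move=> [_ X1] [_ Y1] s; rewrite big_split/= -!mulr_sumr X1 Y1; ring.
Qed.

(** A lottery with all entries positive: adding a small enough multiple of any balanced act leaves
    it a lottery. *)
Definition uniform : act R S K := fun _ _ => K.+1%:R^-1.

Lemma uniform_lottery : lottery uniform.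
Proof.
split=> [s c|s]; first by rewrite invr_ge0.
by rewrite sumr_const card_ord -[LHS]mulr_natr mulVf// pnatr_eq0.
Qed.

Lemma uniform_add_lottery Z (M : R) : balanced Z -> 0 < M ->
  (forall s c, `|Z s c| <= M) ->
  lottery (lin 1 uniform (K.+1%:R^-1 / M) Z).
Proof.
move=> Z0 M0 ZM; split=> [s c|s].
  rewrite /lin /uniform mul1r -mulrA -[X in X + _]mulr1 -mulrDr.
  rewrite mulr_ge0 ?invr_ge0//.
  rewrite -lerBlDl sub0r mulrC ler_pdivlMr// mulN1r.
  by have := ZM s c; rewrite ler_norml => /andP[].
by rewrite big_split/= -!mulr_sumr Z0 uniform_lottery.2; ring.
Qed.

Definition on_event E X : act R S K := fun s c => ind E s * X s c.

Lemma on_event_lin E a X b Y :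
  on_event E (lin a X b Y) = lin a (on_event E X) b (on_event E Y).
Proof. by apply: actP => s c; rewrite /on_event /lin; ring. Qed.

Lemma expU_on_event1 v s X : expU v (on_event [set s] X) = \sum_c X s c * v s c.
Proof.
rewrite /expU (bigD1 s)//= [X in _ + X]big1 ?addr0.
  by apply: eq_bigr => c _; rewrite /on_event /ind finset.inE eqxx mul1r.
move=> s' /negbTE s's; rewrite big1// => c _.
by rewrite /on_event /ind finset.inE s's !mul0r.
Qed.

Lemma expU_on_event1_sure v s c : expU v (on_event [set s] (sure c)) = v s c.
Proof. by rewrite expU_on_event1 sum_delta. Qed.

End Lotteries.

(** * The closed convex cone of preferred differences *)

Section PreferenceCone.
Context {R : realType} {S : finType} {K : nat}.
Implicit Types (pref : preference R S K) (X Y Z v W : act R S K)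
  (E F : {set S}).

Definition pref_cone pref : set (act R S K) := [set Z | exists X Y t,
  [/\ lottery X, lottery Y, pref X Y, 0 < t & Z = lin t X (- t) Y]].

Lemma pref_cone_balanced pref Z : pref_cone pref Z -> balanced Z.
Proof. by move=> [X [Y [t [lX lY _ _ ->]]]]; exact: balanced_sub. Qed.

Lemma pref_cone_sub pref X Y : lottery X -> lottery Y -> pref X Y ->
  pref_cone pref (lin 1 X (-1) Y).
Proof. by move=> lX lY XY; exists X, Y, 1. Qed.

(** A preference depends only on the direction of the difference. If X - Y = r t (X' - Y') and a = 1
    / (1 + r t), then a X + (1 - a) Y' = (1 - a) X' + a Y; so A2 mixes X' >~ Y' with Y, and A2 again
    cancels Y'. *)
Lemma pref_coneP pref X Y Z (r : R) : A1 pref -> A2 pref ->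
  lottery X -> lottery Y -> pref_cone pref Z -> 0 <= r ->
  lin 1 X (-1) Y = lin r Z 0 Z -> pref X Y.
Proof.
move=> [refl trans] indep lX lY [X' [Y' [t [lX' lY' XY' t0 ->]]]] r0 XYE.
have {}XYE s c : X s c - Y s c = r * t * (X' s c - Y' s c).
  by have := congr1 (fun f => f s c) XYE; rewrite /lin; lra.
move: r0; rewrite le_eqVlt => /predU1P[r0|r0].
  suff -> : X = Y by exact: refl.
  by apply: actP => s c; apply/eqP; rewrite -subr_eq0 XYE -r0 !mul0r.
have rt0 : 0 < r * t by rewrite mulr_gt0.
pose a := (1 + r * t)^-1.
have a0 : 0 < a by rewrite invr_gt0; lra.
have aE : a * (r * t) = 1 - a by rewrite /a; field; lra.
have a1 : a < 1 by rewrite -subr_gt0 -aE mulr_gt0.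
have mixX : mix (1 - a) X' Y = mix a X Y'.
  apply: actP => s c; rewrite /mix.
  suff : a * (X s c - Y s c) = (1 - a) * (X' s c - Y' s c) by lra.
  by rewrite XYE mulrA aE.
have mixY : mix (1 - a) Y' Y = mix a Y Y' by apply: actP => s c; rewrite /mix; ring.
apply/(indep X Y Y' a) => //; first by rewrite a0.
rewrite -mixX -mixY; apply/(indep X' Y' Y (1 - a)) => //.
by rewrite subr_gt0 a1 /=; lra.
Qed.

Lemma pref_mix pref a X X' Y Y' : A1 pref -> A2 pref ->
  lottery X -> lottery X' -> lottery Y -> lottery Y' -> 0 <= a <= 1 ->
  pref X Y -> pref X' Y' -> pref (mix a X X') (mix a Y Y').
Proof.
move=> [refl trans] indep lX lX' lY lY' /andP[a0 a1] XY XY'.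
have mix0 Z Z' : mix 0 Z Z' = Z' by apply: actP => s c; rewrite /mix; ring.
have mix1 Z Z' : mix 1 Z Z' = Z by apply: actP => s c; rewrite /mix; ring.
have mixC Z Z' : mix a Z Z' = mix (1 - a) Z' Z.
  by apply: actP => s c; rewrite /mix; ring.
move: a0; rewrite le_eqVlt => /predU1P[<-|a0]; first by rewrite !mix0.
move: a1; rewrite le_eqVlt => /predU1P[->|a1]; first by rewrite !mix1.
have a01 : 0 <= a <= 1 by rewrite !ltW.
apply: (trans _ (mix a Y X')); do ?exact: mix_lottery.
  by apply: (indep _ _ _ _ lX lY lX' _).1 => //; rewrite a0 a1.
rewrite !(mixC Y); apply: (indep _ _ _ _ lX' lY' lY _).1 => //.
by apply/andP; split; lra.
Qed.

Lemma pref_cone_convex pref : A1 pref -> A2 pref -> convex_cone (pref_cone pref).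
Proof.
move=> ax1 ax2; split.
  exists (lin 1 uniform (-1) uniform).
  apply: pref_cone_sub; try exact: uniform_lottery.
  by apply: ax1.1; exact: uniform_lottery.
move=> a b _ _ a0 b0 [X [Y [t [lX lY XY t0 ->]]]]
  [X' [Y' [t' [lX' lY' XY' t'0 ->]]]].
have at0 : 0 <= a * t by rewrite mulr_ge0// ltW.
have bt0 : 0 <= b * t' by rewrite mulr_ge0// ltW.
have : 0 <= a * t + b * t' by rewrite addr_ge0.
rewrite le_eqVlt => /predU1P[m0|m0].
  exists X, X, 1; split => //; first exact: ax1.1.
  have aE : a * t = 0 by lra.
  have bE : b * t' = 0 by lra.
  by apply: actP => s c; rewrite /lin !mulNr !mulrDr !mulrN !mulrA aE bE; ring.
pose r := a * t / (a * t + b * t').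
have rE : (a * t + b * t') * r = a * t by rewrite mulrC mulfVK// gt_eqF.
have r01 : 0 <= r <= 1.
  rewrite /r ler_pdivrMr// mul1r lerDl bt0 andbT.
  by apply: divr_ge0 => //; exact: ltW.
exists (mix r X X'), (mix r Y Y'), (a * t + b * t'); split => //.
- exact: mix_lottery.
- exact: mix_lottery.
- exact: pref_mix.
- apply: actP => s c; rewrite /lin /mix.
  set m := a * t + b * t' in rE *.
  transitivity (m * r * (X s c - Y s c) + (m - m * r) * (X' s c - Y' s c)).
    by rewrite rE /m; ring.
  by ring.
Qed.

Lemma pref_cone0 pref : A1 pref -> A2 pref -> pref_cone pref (fun _ _ => 0).
Proof.
move=> ax1 ax2; have [[X CX] Clin] := pref_cone_convex ax1 ax2.
suff <- : lin 0 X 0 X = fun _ _ => 0 by exact: Clin.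
by apply: actP => s c; rewrite /lin; ring.
Qed.

(** The lotteries and factors witnessing membership along a convergent sequence need not converge.
    But the sequence has one entrywise bound [M], so a common factor turns every term into the
    difference of a lottery and [uniform], and A3 applies to these lotteries. *)
Lemma pref_cone_closed pref : A1 pref -> A2 pref -> A3 pref ->
  seq_closed (pref_cone pref).
Proof.
move=> ax1 ax2 ax3 u Z Cu uZ.
have ubd (i : S * 'I_K.+1) : exists b : R, forall n, `|u n i.1 i.2| <= b.
  have cvu : cvgn (fun n => u n i.1 i.2).
    by apply/cvg_ex; exists (Z i.1 i.2); exact: uZ.
  have /ex_bound[|b bu] := cvg_seq_bounded cvu.
    exact: (globally_properfilter (a := 0%N)).
  by exists b => n; exact: bu.
have [B HB] := choice ubd.
pose M := 1 + \sum_i `|B i|.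
have M0 : 0 < M by rewrite ltr_pwDl// sumr_ge0.
have uM n s c : `|u n s c| <= M.
  apply: (le_trans (HB (s, c) n)); rewrite (le_trans (ler_norm _))//.
  by rewrite /M (bigD1 (s, c))//= addrCA lerDl addr_ge0// sumr_ge0.
have ZM s c : `|Z s c| <= M.
  apply: (@cvgn_le _ (fun n => `|u n s c|)) => //.
  by apply: cvg_norm; exact: uZ.
have Zbal : balanced Z.
  move=> s; have cv : (fun n => \sum_c u n s c) @ \oo --> \sum_c Z s c.
    by apply: cvg_big => [|c _]; [exact: add_continuous|exact: uZ].
  rewrite -(cvg_lim _ cv)//; apply: lim_near_cst => //.
  by apply: nearW => n; exact: pref_cone_balanced (Cu n) s.
pose e := K.+1%:R^-1 / M.
have e0 : 0 < e by rewrite divr_gt0.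
pose shift Z := lin 1 uniform e Z.
have lU := @uniform_lottery R S K.
have shiftE X : lin 1 (shift X) (-1) uniform = lin e X 0 X.
  by apply: actP => s c; rewrite /shift /lin; ring.
have lshift n : lottery (shift (u n)).
  by apply: uniform_add_lottery => //; exact: pref_cone_balanced (Cu n).
have ZU : pref (shift Z) uniform.
  apply: (ax3 (fun n => shift (u n)) (fun=> uniform)) => //.
  - by apply: cvg_lin => // s c; exact: cvg_cst.
  - by move=> s c; exact: cvg_cst.
  - by move=> n; apply: (pref_coneP ax1 ax2 _ _ (Cu n) (ltW e0)).
exists (shift Z), uniform, e^-1; split => //.
- exact: uniform_add_lottery.
- by rewrite invr_gt0.
- by apply: actP => s c; rewrite /shift /lin; field; rewrite gt_eqF.
Qed.

End PreferenceCone.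

(** * Normalized separating functionals and their product form *)

Section Duality.
Context {R : realType} {S : finType} {K : nat}.
Implicit Types (pref : preference R S K) (X Y Z v W d : act R S K)
  (E F : {set S}).

Lemma best_or_worst_or_gt1 (c : 'I_K.+1) :
  [\/ c = worst, c = best | (1 < c)%N].
Proof.
case: c => [[|[|n]] cK].
- by apply: Or31; exact: val_inj.
- by apply: Or32; apply: val_inj; rewrite /= inordK.
- exact: Or33.
Qed.

Lemma pref_sure pref c : axioms pref ->
  pref (sure best) (sure c) /\ pref (sure c) (sure worst).
Proof.
move=> [[refl _] _ _ [ax4 [bw _] _]].
have r c' := refl _ (sure_lottery c').
by case: (best_or_worst_or_gt1 c) => [->|->|/ax4].
Qed.

Lemma lin_cone pref a b X Y : A1 pref -> A2 pref -> 0 <= a -> 0 <= b ->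
  pref_cone pref X -> pref_cone pref Y -> pref_cone pref (lin a X b Y).
Proof. by move=> ax1 ax2; exact: (pref_cone_convex ax1 ax2).2. Qed.

(** Presents a constant difference by two constant lotteries, as A6* requires. *)
Lemma constant_balanced_sub d (s0 : S) : constant_act d -> balanced d ->
  exists X t, [/\ lottery X, constant_act X, 0 < t & d = lin t X (- t) uniform].
Proof.
move=> cd d0.
pose M := 1 + \sum_c `|d s0 c|.
have M0 : 0 < M by rewrite ltr_pwDl// sumr_ge0.
have dM s c : `|d s c| <= M.
  rewrite (cd s s0) /M (bigD1 c)//= addrCA lerDl addr_ge0// sumr_ge0//.
have e0 : 0 < K.+1%:R^-1 / M :> R by rewrite divr_gt0// invr_gt0.
exists (lin 1 uniform (K.+1%:R^-1 / M) d), (K.+1%:R^-1 / M)^-1; split.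
- exact: uniform_add_lottery.
- by move=> s s' c; rewrite /lin (cd s s').
- by rewrite invr_gt0.
- by apply: actP => s c; rewrite /lin; field; rewrite !gt_eqF.
Qed.

(* This is A6* with E = S, p = q = 1 and beta = alpha. *)
Lemma pref_cone_on_event pref W d F : axioms pref -> best_on_events pref ->
  (0 < #|S|)%N -> constant_act d -> balanced d ->
  pref_cone pref W -> pref_cone pref (lin 1 d 1 W) ->
  pref_cone pref (lin 1 (on_event F d) 1 W).
Proof.
move=> [ax1 ax2 ax3 [ax4 ax5 ax6]] boe /card_gt0P[s0 _] cd d0.
have [X [t [lX cX t0 dE]]] := constant_balanced_sub s0 cd d0.
have lU := @uniform_lottery R S K.
move=> [X' [Y' [r [lX' lY' XY' r0 WE]]]] dW.
have tr0 : 0 < t + r by rewrite addr_gt0.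
(* As d = t (X - uniform) and W = r (X' - Y'), this weight makes the difference of the two mixtures
   (d + W) / (t + r), with [d] restricted to the event; the completion [Z] cancels. *)
pose a := t / (t + r).
have aE : 1 - a = r / (t + r) by rewrite /a; field; rewrite gt_eqF.
have a1 : a < 1 by rewrite -subr_gt0 aE divr_gt0.
have a0 : 0 <= a by rewrite divr_ge0// ltW.
have a01 : 0 <= a <= 1 by rewrite a0 ltW.
have mixE G Z : lin 1 (mix a (onev G X Z) X') (-1) (mix a (onev G uniform Z) Y') =
    lin (t + r)^-1 (lin 1 (on_event G d) 1 W) 0 (lin 1 (on_event G d) 1 W).
  apply: actP => s c; rewrite dE WE /lin /mix /on_event /onev aE /a.
  by field; rewrite gt_eqF.
have on_eventT : on_event [set: S] d = d.
  by apply: actP => s c; rewrite /on_event /ind finset.in_setT mul1r.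
have called_offT : called_off pref a [set: S] X X' uniform Y'.
  move=> Z lZ; apply: (pref_coneP (r := (t + r)^-1) ax1 ax2 _ _ dW _ _).
  - by apply: mix_lottery => //; exact: onev_lottery.
  - by apply: mix_lottery => //; exact: onev_lottery.
  - by rewrite invr_ge0 ltW.
  - by rewrite mixE on_eventT.
have HbestT : Hevent [set: S] = sure best :> act R S K.
  by apply: actP => s c; rewrite /Hevent /onev /ind finset.in_setT /=; ring.
have Hbest1 : Hprob 1 = sure best :> act R S K.
  by apply: actP => s c; rewrite /Hprob /mix; ring.
have lb := @sure_lottery R S K best.
have : called_off pref a F X X' uniform Y'.
  apply: (ax6 _ _ _ _ _ _ 1 1 _ _ lX lU lX' lY' cX _ XY' _ _ _ _ a01 _ called_offT).
  - by [].
  - by rewrite ltr01 lexx.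
  - by rewrite ltr01 lexx.
  - by rewrite HbestT Hbest1; exact: ax1.1.
  - by rewrite Hbest1.
  - by right; rewrite a0 a1 divr1 mulr1 lexx.
move=> /(_ _ lX') /pref_cone_sub h.
set FdW := lin 1 (on_event F d) 1 W.
have {}h : pref_cone pref (lin (t + r)^-1 FdW 0 FdW).
  by rewrite -(mixE F X'); apply: h; apply: mix_lottery => //;
    exact: onev_lottery.
suff -> : FdW = lin (t + r) (lin (t + r)^-1 FdW 0 FdW) 0 W.
  by apply: lin_cone => //; [exact: ltW|exists X', Y', r].
by apply: actP => s c; rewrite /lin; field; rewrite gt_eqF.
Qed.

(** The case W = 0 of [pref_cone_on_event]: rankings of sure consequences hold state by state. *)
Lemma pref_cone_state pref s c c' : axioms pref -> best_on_events pref ->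
  pref (sure c) (sure c') ->
  pref_cone pref (on_event [set s] (lin 1 (sure c) (-1) (sure c'))).
Proof.
move=> ax boe cc'; have [ax1 ax2 _ _] := ax.
have S0 : (0 < #|S|)%N by apply/card_gt0P; exists s.
pose O : act R S K := fun _ _ => 0.
have addO X : lin 1 X 1 O = X by apply: actP => s' c1; rewrite /lin /O; ring.
have O0 : pref_cone pref O by exact: pref_cone0.
have lc := @sure_lottery R S K.
rewrite -[on_event _ _]addO; apply: pref_cone_on_event => //.
- exact: balanced_sub.
- by rewrite addO; exact: pref_cone_sub.
Qed.

Definition dual_Vpp pref : set (act R S K) :=
  [set v | Vpp v /\ forall Z, pref_cone pref Z -> 0 <= expU v Z].

Lemma Vpp_le1 v : Vpp v -> forall s c, `|v s c| <= 1.
Proof.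
move=> [_ vc v1 _] s c; have /andP[h1 h2] := vc s c.
by rewrite ger0_norm// (le_trans h2).
Qed.

Lemma Vpp_closed : seq_closed (@Vpp R S K).
Proof.
move=> u v Hu uv; split.
- move=> s; apply/eqP; rewrite eq_le; apply/andP; split.
    by apply: cvgn_le (uv s worst) _ => n; have [-> _ _ _] := Hu n.
  by apply: cvgn_ge (uv s worst) _ => n; have [-> _ _ _] := Hu n.
- move=> s c; apply/andP; split.
    by apply: cvgn_ge (uv s c) _ => n; have [_ /(_ s c)/andP[]] := Hu n.
  rewrite -subr_ge0; apply: (@cvgn_ge _ (fun n => u n s best - u n s c)).
    by apply: cvgB; exact: uv.
  by move=> n; rewrite subr_ge0; have [_ /(_ s c)/andP[]] := Hu n.
- by move=> s; apply: cvgn_le (uv s best) _ => n; have [_ _ ->] := Hu n.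
- have cv : (fun n => \sum_s u n s best) @ \oo --> \sum_s v s best.
    by apply: cvg_big => [|s _]; [exact: add_continuous|exact: uv].
  apply/eqP; rewrite eq_le; apply/andP; split.
    by apply: cvgn_le cv _ => n; have [_ _ _ ->] := Hu n.
  by apply: cvgn_ge cv _ => n; have [_ _ _ ->] := Hu n.
Qed.

Lemma dual_Vpp_closed pref : seq_closed (dual_Vpp pref).
Proof.
move=> u v Hu uv; split; first by apply: Vpp_closed uv => n; exact: (Hu n).1.
move=> Z CZ; apply: (@cvgn_ge _ (fun n => expU (u n) Z)).
  by apply: cvg_expU => // s c; exact: cvg_cst.
by move=> n; exact: (Hu n).2.
Qed.

(** On balanced acts a separating [g] matters only up to a constant in each state, so its value at
    [worst] may be made 0. By [pref_cone_state] the result [h] lies between 0 and its value at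
    [best]; it is nonzero, being negative at Y, so dividing by the total at [best] puts it in
    [Vpp]. *)
Lemma dual_separation pref Y : axioms pref -> best_on_events pref ->
  balanced Y -> ~ pref_cone pref Y -> exists2 v, dual_Vpp pref v & expU v Y < 0.
Proof.
move=> ax boe Y0 nY; have [ax1 ax2 ax3 _] := ax.
have [g g0 gY] := cone_separation (pref_cone_convex ax1 ax2)
  (pref_cone_closed ax1 ax2 ax3) nY.
pose h : act R S K := fun s c => g s c - g s worst.
have hE Z : balanced Z -> expU h Z = expU g Z.
  move=> Z0; apply: eq_bigr => s _; rewrite /h.
  under eq_bigr do rewrite mulrBr.
  by rewrite sumrB -mulr_suml Z0 mul0r subr0.
have state s c c' : pref (sure c) (sure c') -> g s c' <= g s c.
  move=> /(pref_cone_state s ax boe)/g0.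
  by rewrite on_event_lin expU_linr !expU_on_event1_sure mul1r mulN1r subr_ge0.
have h_ge0 s c : 0 <= h s c by rewrite subr_ge0 state//; exact: (pref_sure c ax).2.
have h_le s c : h s c <= h s best.
  by rewrite lerD2r state//; exact: (pref_sure c ax).1.
have b0 : 0 <= \sum_s h s best by exact: sumr_ge0.
have hY : expU h Y < 0 by rewrite hE.
have b_gt0 : 0 < \sum_s h s best.
  rewrite lt_neqAle b0 andbT eq_sym; apply/eqP => /eqP.
  rewrite psumr_eq0// => /allP hb.
  have hz s c : h s c = 0.
    apply/eqP; rewrite eq_le h_ge0 andbT.
    by have /eqP <- := hb s (mem_index_enum s); exact: h_le.
  move: hY; rewrite /expU big1 ?ltxx// => s _.
  by rewrite big1// => c _; rewrite hz mulr0.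
pose b := (\sum_s h s best)^-1.
have b'0 : 0 < b by rewrite invr_gt0.
exists (lin b h 0 h); last by rewrite expU_linl mul0r addr0 pmulr_rlt0.
have lE s c : lin b h 0 h s c = b * h s c by rewrite /lin mul0r addr0.
have sum1 : \sum_s lin b h 0 h s best = 1.
  by under eq_bigr do rewrite lE; rewrite -mulr_sumr mulVf// gt_eqF.
have l_ge0 s c : 0 <= lin b h 0 h s c by rewrite lE mulr_ge0// ltW.
split; first split=> //.
- by move=> s; rewrite lE /h subrr mulr0.
- by move=> s c; rewrite l_ge0 !lE ler_pM2l ?h_le.
- by move=> s; rewrite -sum1 (bigD1 s)//= lerDl sumr_ge0.
- move=> Z CZ; rewrite expU_linl mul0r addr0 hE ?mulr_ge0 ?g0 ?ltW//.
  exact: pref_cone_balanced CZ.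
Qed.

(* Puts row sums to 0 by changing only the worst consequence, to which every
   function of Vpp assigns utility 0. *)
Definition rebalance X : act R S K :=
  fun s c => X s c - (c == worst)%:R * \sum_c' X s c'.

Lemma rebalance_balanced X : balanced (rebalance X).
Proof.
move=> s; rewrite sumrB; apply/eqP; rewrite subr_eq0; apply/eqP.
by rewrite (sum_delta (fun=> \sum_c' X s c')).
Qed.

Lemma expU_rebalance v X : Vpp v -> expU v (rebalance X) = expU v X.
Proof.
move=> [v0 _ _ _]; apply: eq_bigr => s _; apply: eq_bigr => c _.
rewrite /rebalance mulrBl; have [->|_] := eqVneq c worst.
  by rewrite v0 !mulr0 subr0.
by rewrite !mul0r subr0.
Qed.

Lemma expU_best v : Vpp v -> expU v (sure best) = 1.
Proof. by move=> [_ _ _ v1]; rewrite expU_sure. Qed.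

Lemma expU_worst v : Vpp v -> expU v (sure worst) = 0.
Proof. by move=> [v0 _ _ _]; rewrite expU_sure big1. Qed.

(* Recentred to W, the exposing functional vanishes at v and is at least
   |v' - v|^2, so d + l W is nonnegative on the dual for large l, although d
   alone may not be. Hence d + l W is in the cone; call d off outside F and
   evaluate at v. *)
Lemma exposed_on_event pref v w d F : axioms pref -> best_on_events pref ->
  dual_Vpp pref v ->
  (forall v', dual_Vpp pref v' -> sqdist v' v <= expU v w - expU v' w) ->
  constant_act d -> balanced d -> 0 < expU v d -> 0 <= expU v (on_event F d).
Proof.
move=> ax boe Dv vw cd d0 vd; have [Vv _] := Dv.
have S0 : (0 < #|S|)%N.
  rewrite lt0n; apply/eqP => S0; move: vd; rewrite /expU big1 ?ltxx// => s _.
  by have := card0_eq S0 s; rewrite inE.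
(* Every function of [Vpp] gives [sure best] expected utility 1, so that act supplies the constant
   term of an affine functional. *)
pose W := rebalance (lin (expU v w) (sure best) (-1) w).
have WE v' : Vpp v' -> expU v' W = expU v w - expU v' w.
  by move=> Vv'; rewrite expU_rebalance// expU_linr expU_best//; ring.
have bW : balanced W by exact: rebalance_balanced.
have bipolar Z : balanced Z -> (forall v', dual_Vpp pref v' -> 0 <= expU v' Z) ->
    pref_cone pref Z.
  move=> Z0 HZ; apply: contrapT => /(dual_separation ax boe Z0)[v' Dv'].
  by rewrite ltNge HZ.
(* Chosen for |d|^2 <= 2 l <v, d>. Together with |d + l (v' - v)|^2 >= 0 and <v', W> >= |v' - v|^2
   this yields <v', d + l W> >= 0. *)
pose l := expU d d / (2 * expU v d) + 1.
have l0 : 0 < l by rewrite ltr_wpDl// divr_ge0 ?expU_sqr_ge0// mulr_ge0// ltW.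
have lE : expU d d <= 2 * l * expU v d.
  have -> : 2 * l * expU v d = expU d d + 2 * expU v d.
    by rewrite /l; field; rewrite gt_eqF.
  by rewrite lerDl mulr_ge0// ltW.
have CW : pref_cone pref (lin l W 0 W).
  apply: bipolar => [|v' Dv']; first exact: balanced_lin.
  rewrite expU_linr mul0r addr0 (mulr_ge0 (ltW l0))// (WE _ Dv'.1).
  by apply: le_trans (vw _ Dv'); exact: expU_sqr_ge0.
have CdW : pref_cone pref (lin 1 d 1 (lin l W 0 W)).
  apply: bipolar => [|v' Dv']; first by do !apply: balanced_lin.
  rewrite !expU_linr (WE _ Dv'.1).
  have ll : 0 <= l * l by rewrite mulr_ge0// ltW.
  have := mulr_ge0 ll (expU_sqr_ge0 (lin 1 v' (-1) v)).
  have := ler_wpM2l ll (vw _ Dv'); rewrite -/(sqdist v' v) sqdistE => vw' q0.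
  have := expU_sqr_ge0 (lin 1 d l (lin 1 v' (-1) v)).
  rewrite !expU_linl !expU_linr (expUC d v') (expUC d v) (expUC v v') => h.
  rewrite -(pmulr_rge0 _ l0); lra.
have := pref_cone_on_event F ax boe S0 cd d0 CW CdW.
by move=> /Dv.2; rewrite !expU_linr WE// subrr mul1r !mulr0 addr0 mul1r addr0.
Qed.

(** The probability is v(s, best) and the utility u(c) is the sum of v(s, c) over s. The difference
    of [sure c] and the mixture of best and worst with weight u(c) has expected utility 0 under v;
    adding e (best - worst) makes it positive, so [exposed_on_event] applies in each state. Both
    signs and e tending to 0 give equality. *)
Lemma exposed_prob_utility pref v w : axioms pref -> best_on_events pref ->
  dual_Vpp pref v ->
  (forall v', dual_Vpp pref v' -> sqdist v' v <= expU v w - expU v' w) ->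
  prob_utility v.
Proof.
move=> ax boe Dv vw; have [[v0 vc v1 vsum] _] := Dv.
have Vv := Dv.1.
exists (fun s => v s best), (fun c => \sum_s v s c); split=> //.
  by move=> s; rewrite v1 andbT; have /andP[] := vc s best.
move=> s c; set u := \sum_s v s c.
have key (sg e : R) : 0 < e -> 0 <= sg * (v s c - v s best * u) + e * v s best.
  move=> e0.
  pose d : act R S K :=
    lin sg (lin 1 (sure c) (-1) (mix u (sure best) (sure worst)))
    e (lin 1 (sure best) (-1) (sure worst)).
  have lsure := @sure_lottery R S K.
  have bd : balanced d.
    move=> s'; rewrite !big_split/= -!mulr_sumr !big_split/= -!mulr_sumr.
    rewrite big_split/= -!mulr_sumr.
    by rewrite !(lsure _).2; ring.
  have vd : expU v d = e.
    by rewrite !expU_linr expU_best// expU_worst// expU_sure -/u; ring.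
  have : 0 <= expU v (on_event [set s] d).
    by apply: exposed_on_event vw _ bd _ => //; rewrite vd.
  rewrite !on_event_lin !expU_linr !expU_on_event1_sure v0; lra.
have vs0 : 0 <= v s best by have /andP[] := vc s best.
apply/eqP; rewrite -subr_eq0 eq_le; apply/andP; split; apply/ler_addgt0Pr => e e0.
  have := key (-1) e e0; have := v1 s; nra.
have := key 1 e e0; have := v1 s; nra.
Qed.

Lemma exists_prob_utility pref X Y : axioms pref -> best_on_events pref ->
  lottery X -> lottery Y -> ~ pref X Y ->
  exists v, [/\ dual_Vpp pref v, prob_utility v & expU v X < expU v Y].
Proof.
move=> ax boe lX lY nXY; have [ax1 ax2 _ _] := ax.
have bXY : balanced (lin 1 X (-1) Y) by exact: balanced_sub.
have nC : ~ pref_cone pref (lin 1 X (-1) Y).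
  move=> CXY; apply: nXY; apply: (pref_coneP ax1 ax2 lX lY CXY ler01).
  by apply: actP => s c; rewrite /lin; ring.
have [v0 Dv0 v0XY] := dual_separation ax boe bXY nC.
have [v [w [Dv vXY vw]]] := exists_exposed
  (fun v (Dv : dual_Vpp pref v) => Vpp_le1 Dv.1) (@dual_Vpp_closed pref) Dv0 v0XY.
exists v; split=> //; first exact: exposed_prob_utility vw.
by move: vXY; rewrite expU_linr mul1r mulN1r subr_lt0.
Qed.

End Duality.

(** * From a representation by probability/utility pairs to the axioms *)

Section Representations.
Context {R : realType} {S : finType} {K : nat}.
Implicit Types (pref : preference R S K) (X Y Z v : act R S K)
  (P V : set (act R S K)) (E : {set S}).

Lemma sub_conv_hull P : P `<=` conv_hull P.
Proof.
move=> v Pv; exists 1%N, (fun=> 1), (fun=> v); split => // [|s c].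
  by rewrite big_ord1.
by rewrite big_ord1 mul1r.
Qed.

Lemma conv_hull_Vpp P : P `<=` Vpp -> conv_hull P `<=` Vpp.
Proof.
move=> PV v [n [w [f [w0 w1 Pf vE]]]].
have vsum : \sum_s v s best = 1.
  under eq_bigr do rewrite vE.
  rewrite exchange_big/= -w1; apply: eq_bigr => i _.
  by rewrite -mulr_sumr; have [_ _ _ ->] := PV _ (Pf i); rewrite mulr1.
have v0 s c : 0 <= v s c.
  rewrite vE sumr_ge0// => i _; rewrite mulr_ge0//.
  by have [_ /(_ s c)/andP[]] := PV _ (Pf i).
split=> //.
- move=> s; rewrite vE big1// => i _.
  by have [-> _ _ _] := PV _ (Pf i); rewrite mulr0.
- move=> s c; rewrite v0 !vE ler_sum// => i _; rewrite ler_wpM2l//.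
  by have [_ /(_ s c)/andP[]] := PV _ (Pf i).
- by move=> s; rewrite -vsum (bigD1 s)//= lerDl sumr_ge0.
Qed.

(** [expU] is linear in the utility function, so the hull adds no constraint. *)
Lemma conv_hull_expU_ge P X Y :
  (forall v, P v -> 0 <= expU v X - expU v Y) ->
  forall v, conv_hull P v -> 0 <= expU v X - expU v Y.
Proof.
move=> HP v [n [w [f [w0 _ Pf vE]]]].
have vZ Z : expU v Z = \sum_i w i * expU (f i) Z.
  under [RHS]eq_bigr do rewrite mulr_sumr.
  rewrite exchange_big/=; apply: eq_bigr => s _.
  under [RHS]eq_bigr do rewrite mulr_sumr.
  rewrite exchange_big/=; apply: eq_bigr => c _.
  by rewrite vE mulr_sumr; apply: eq_bigr => i _; rewrite mulrCA.
rewrite !vZ -sumrB sumr_ge0// => i _; rewrite -mulrBr mulr_ge0//.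
by apply: HP.
Qed.

Lemma represents_conv_hull P pref :
  represents (conv_hull P) pref <-> represents P pref.
Proof.
have hullE X Y : (forall v, conv_hull P v -> 0 <= expU v X - expU v Y) <->
    (forall v, P v -> 0 <= expU v X - expU v Y).
  by split=> [H v /sub_conv_hull/H|]; last exact: conv_hull_expU_ge.
by split=> H X Y lX lY; rewrite H// hullE.
Qed.

Lemma expU_onev v E X Y Z :
  expU v (onev E X Z) - expU v (onev E Y Z) =
  expU v (on_event E (lin 1 X (-1) Y)).
Proof.
transitivity (expU v (lin 1 (onev E X Z) (-1) (onev E Y Z))).
  by rewrite expU_linr; ring.
by congr expU; apply: actP => s c; rewrite /lin /onev /on_event; ring.
Qed.

Lemma expU_Hevent v E : Vpp v -> expU v (Hevent E) = \sum_(s in E) v s best.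
Proof.
move=> [v0 _ _ _]; rewrite /Hevent big_mkcond; apply: eq_bigr => s _.
rewrite /onev /ind; case: (s \in E) => /=.
  rewrite -[RHS](sum_delta (fun c => v s c)); apply: eq_bigr => c _.
  by rewrite /sure; ring.
rewrite -[RHS](v0 s) -[RHS](sum_delta (fun c => v s c)); apply: eq_bigr => c _.
by rewrite /sure; ring.
Qed.

Lemma expU_Hprob v (p : R) : Vpp v -> expU v (Hprob p) = p.
Proof. by move=> Vv; rewrite expU_mix expU_best// expU_worst//; ring. Qed.

(** Normalization forces u(best) = 1, so the first factor is the probability of E. This independence
    of tastes and events is what validates A6*. *)
Lemma expU_on_event_const v E X : Vpp v -> prob_utility v -> constant_act X ->
  expU v (on_event E X) = expU v (Hevent E) * expU v X.
Proof.
move=> Vv [p [u [p01 p1 vE]]] cX; rewrite expU_Hevent//.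
have [_ _ _ vsum] := Vv.
have ub : u best = 1.
  by rewrite -vsum; under eq_bigr do rewrite vE; rewrite -mulr_suml p1 mul1r.
have [s0 _|noS] := pickP [pred s : S | true]; last first.
  move: p1; rewrite big1 => [/eqP|s _]; first by rewrite eq_sym oner_eq0.
  by have := noS s.
have rowE s : \sum_c X s c * v s c = p s * \sum_c X s0 c * u c.
  by rewrite mulr_sumr; apply: eq_bigr => c _; rewrite vE (cX s s0) mulrCA.
rewrite [in RHS]/expU; under [X in _ = _ * X]eq_bigr do rewrite rowE.
rewrite -mulr_suml p1 mul1r mulr_suml.
rewrite /expU [RHS]big_mkcond; apply: eq_bigr => s _.
rewrite /on_event /ind; under eq_bigr do rewrite -mulrA.
rewrite -mulr_sumr rowE; case: (s \in E) => /=; last by rewrite mul0r.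
by rewrite vE ub mulr1 mul1r.
Qed.

Lemma represents_axioms P pref : P !=set0 -> P `<=` Vpp ->
  (forall v, P v -> prob_utility v) -> represents P pref ->
  axioms pref /\ best_on_events pref.
Proof.
move=> [v1 Pv1] PV Ppu rep.
have ls := @sure_lottery R S K.
have lm a X Y : 0 <= a <= 1 -> lottery X -> lottery Y -> lottery (mix a X Y).
  exact: mix_lottery.
split; last first.
  move=> F; apply/rep => //; first exact: Hevent_lottery.
  move=> v /PV Vv; rewrite expU_best// expU_Hevent//.
  have [_ vc _ <-] := Vv.
  rewrite [X in X - _](bigID (mem F))/= addrAC subrr add0r sumr_ge0// => s _.
  by have /andP[] := vc s best.
split.
- split=> [X lX|X Y Z lX lY lZ].
    by apply/rep => // v _; rewrite subrr.
  move=> /(rep _ _ lX lY) XY /(rep _ _ lY lZ) YZ; apply/rep => // v Pv.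
  by have := XY v Pv; have := YZ v Pv; lra.
- move=> X Y Z a lX lY lZ /andP[a0 a1].
  have a01 : 0 <= a <= 1 by rewrite !ltW.
  rewrite rep// rep//; do ?exact: lm.
  have aE v : expU v (mix a X Z) - expU v (mix a Y Z) = a * (expU v X - expU v Y).
    by rewrite !expU_mix; ring.
  by split=> H v Pv; have := H v Pv; rewrite aE pmulr_rge0.
- move=> Xn Yn X Y lXn lYn Xl Yl XY.
  have llim (u : nat -> act R S K) Z : (forall n, lottery (u n)) ->
      (forall s c, (fun n => u n s c) @ \oo --> Z s c) -> lottery Z.
    move=> lu uZ; split=> [s c|s].
      by apply: cvgn_ge (uZ s c) _ => n; exact: (lu n).1.
    have cv : (fun n => \sum_c u n s c) @ \oo --> \sum_c Z s c.
      by apply: cvg_big => [|c _]; [exact: add_continuous|exact: uZ].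
    apply/eqP; rewrite eq_le; apply/andP; split.
      by apply: cvgn_le cv _ => n; rewrite (lu n).2.
    by apply: cvgn_ge cv _ => n; rewrite (lu n).2.
  apply/rep; [exact: llim Xl|exact: llim Yl|] => v Pv.
  apply: (@cvgn_ge _ (fun n => expU v (Xn n) - expU v (Yn n))).
    by apply: cvgB; apply: cvg_expU => // s c; exact: cvg_cst.
  by move=> n; exact: (rep _ _ (lXn n) (lYn n)).1 (XY n) v Pv.
- split.
  + move=> c _; split; apply/rep => // v /PV [v0 vc _ _]; rewrite !expU_sure.
      rewrite -sumrB sumr_ge0// => s _.
      by rewrite subr_ge0; have /andP[] := vc s c.
    by rewrite -sumrB sumr_ge0// => s _; rewrite v0 subr0; have /andP[] := vc s c.
  + split.
      by apply/rep => // v /PV Vv; rewrite expU_best// expU_worst// subr0.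
    move=> /(rep _ _ (ls _) (ls _)) /(_ _ Pv1).
    by rewrite expU_best ?expU_worst; [lra|exact: PV|exact: PV].
  + move=> X Y X' Y' E F p q a b lX lY lX' lY' cX cY XY'.
    move=> /andP[p0 p1] /andP[q0 q1].
    have p01 : 0 <= p <= 1 by rewrite ltW.
    have q01 : 0 <= q <= 1 by rewrite ltW.
    have lH := @Hevent_lottery R S K.
    move=> HE HF /andP[a0 a1] ab coE Z lZ.
    have {}HE v : P v -> p <= expU v (Hevent E).
      move=> Pv; have := (rep _ _ (lH _) (lm _ _ _ p01 (ls _) (ls _))).1 HE v Pv.
      by rewrite expU_Hprob ?subr_ge0//; exact: PV.
    have {}HF v : P v -> expU v (Hevent F) <= q.
      move=> Pv; have := (rep _ _ (lm _ _ _ q01 (ls _) (ls _)) (lH _)).1 HF v Pv.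
      by rewrite expU_Hprob ?subr_ge0//; exact: PV.
    have b01 : 0 <= b <= 1.
      case: ab => [[_ ->]|[_ [/andP[b0 b1] _]]]; first by rewrite ler01 lexx.
      by rewrite b0 ltW.
    have a01 : 0 <= a <= 1 by rewrite a0.
    have lo G W : lottery W -> lottery (onev G W Z).
      by move=> lW; exact: onev_lottery.
    apply/rep; [exact/lm/lX'/lo|exact/lm/lY'/lo|] => v Pv.
    have Vv := PV v Pv.
    have cXY : constant_act (lin 1 X (-1) Y).
      by move=> s s' c; rewrite /lin (cX s s') (cY s s').
    pose D := expU v X - expU v Y; pose D' := expU v X' - expU v Y'.
    have mixE G t : expU v (mix t (onev G X Z) X') - expU v (mix t (onev G Y Z) Y')
        = t * (expU v (Hevent G) * D) + (1 - t) * D'.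
      rewrite !expU_mix.
      have := expU_onev v G X Y Z.
      rewrite expU_on_event_const//; last exact: Ppu.
      rewrite [expU v (lin _ _ _ _)]expU_linr /D /D' mul1r mulN1r => <-; ring.
    have D'0 : 0 <= D' := (rep _ _ lX' lY').1 XY' v Pv.
    have := (rep _ _ (lm _ _ _ a01 (lo E _ lX) lX')
      (lm _ _ _ a01 (lo E _ lY) lY')).1 (coE Z lZ) v Pv.
    rewrite !mixE; have := HE v Pv; have := HF v Pv.
    have F0 : 0 <= expU v (Hevent F).
      rewrite expU_Hevent// sumr_ge0// => s _.
      by have [_ /(_ s best)/andP[]] := Vv.
    move: (expU v (Hevent E)) (expU v (Hevent F)) F0 => e f f0 fq pe.
    (* If D >= 0 both terms of the conclusion are nonnegative. If D < 0, the case a = 1 contradicts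
       the premise e D >= 0, as e >= p > 0. *)
    case: (leP 0 D) => [D0 _|D0].
      case/andP: b01 => b0 b1.
      by rewrite addr_ge0// mulr_ge0// ?mulr_ge0// subr_ge0.
    case: ab => [[-> _]|[{}a1 [/andP[b0 {}b1]]]].
      by rewrite mul1r subrr mul0r addr0; nra.
    have ca : 0 < 1 - a by rewrite subr_gt0.
    have cb : 0 < 1 - b by rewrite subr_gt0.
    (* In terms of odds, be f <= be q <= al p <= al e; since D < 0, be f D + D' is at least al e D +
       D', which the premise makes nonnegative. *)
    pose al := a / (1 - a); pose be := b / (1 - b).
    have alE : a = al * (1 - a) by rewrite mulfVK// gt_eqF.
    have beE : b = be * (1 - b) by rewrite mulfVK// gt_eqF.
    have al0 : 0 <= al by rewrite divr_ge0// ltW.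
    have be0 : 0 <= be by rewrite divr_ge0// ltW.
    rewrite -/al -/be mulrA ler_pdivlMr// => bq H.
    have bf : be * f <= al * e.
      by rewrite (le_trans (ler_wpM2l be0 fq))// (le_trans bq)// ler_wpM2l.
    have {}H : 0 <= al * e * D + D'.
      rewrite -(pmulr_rge0 _ ca); move: H; rewrite {1}alE; lra.
    have bfD : al * e * D <= be * f * D by rewrite ler_wnM2r// ltW.
    rewrite {1}beE.
    have -> : be * (1 - b) * (f * D) + (1 - b) * D' = (1 - b) * (be * f * D + D').
      by ring.
    by rewrite mulr_ge0 ?(ltW cb)//; lra.
Qed.

End Representations.

(** * The equivalence, deduced from the representation attached to a basis *)

Theorem theorem4 (R : realType) (S : finType) (K : nat)
    (hS : (0 < #|S|)%N) (hK : (0 < K)%N) (pref : preference R S K) :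
  ((axioms pref /\ best_on_events pref) <->
   (exists V : set (act R S K),
      [/\ V !=set0, V `<=` Vpp,
          (exists P : set (act R S K),
             (forall v, P v -> prob_utility v) /\ V = conv_hull P) &
          represents V pref]))
  /\
  (axioms pref -> best_on_events pref ->
   forall B : preference R S K,
     is_basis (fun Q => axioms Q /\ best_on_events Q) B pref ->
     let V := conv_hull [set v | [/\ Vpp v, prob_utility v &
                forall X Y, B X Y -> expU v X >= expU v Y]] in
     V !=set0 /\ represents V pref).
Proof.
have basis_rep (B : preference R S K) : axioms pref -> best_on_events pref ->
    is_basis (fun Q => axioms Q /\ best_on_events Q) B pref ->
    let P := [set v | [/\ Vpp v, prob_utility v &
               forall X Y, B X Y -> expU v X >= expU v Y]] in
    P !=set0 /\ represents P pref.
  move=> ax boe [Bpref Bmin] P; have [ax1 ax2 _ [_ [_ nbw] _]] := ax.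
  have ls := @sure_lottery R S K.
  have dualP v : dual_Vpp pref v -> prob_utility v -> P v.
    move=> [Vv vd] pu; split=> // X Y /Bpref[lX lY XY].
    have := vd _ (pref_cone_sub lX lY XY).
    by rewrite expU_linr mul1r mulN1r subr_ge0.
  have P0 : P !=set0.
    (* By A5 the preference of worst over best fails, so some pair exists. *)
    have [v [Dv pu _]] := exists_prob_utility ax boe (ls _) (ls _) nbw.
    by exists v; exact: dualP.
  split=> // X Y lX lY; split=> [XY|]; last first.
    move=> H; apply: contrapT => /(exists_prob_utility ax boe lX lY)[v [Dv pu]].
    by rewrite ltNge -subr_ge0 H//; exact: dualP.
  pose Q : preference R S K :=
    fun X Y => forall v, P v -> 0 <= expU v X - expU v Y.
  apply: (Bmin Q) => // [|X1 Y1 BXY v [_ _ /(_ _ _ BXY)]]; last first.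
    by rewrite subr_ge0.
  by apply: (represents_axioms P0) => // v [].
split; last first.
  move=> ax boe B /(basis_rep B ax boe)[[v Pv] rep] V.
  split; first by exists v; exact: sub_conv_hull.
  by apply/represents_conv_hull.
split=> [[ax boe]|[V [[v Vv] VV [P [Ppu VE]] rep]]].
  (* The whole relation is a basis for itself. *)
  pose B : preference R S K := fun X Y => [/\ lottery X, lottery Y & pref X Y].
  have Bbasis : is_basis (fun Q => axioms Q /\ best_on_events Q) B pref.
    by split=> // Q _ BQ X Y lX lY XY; apply: BQ.
  have /=[[v Pv] rep] := basis_rep B ax boe Bbasis.
  eexists; split; last exact/represents_conv_hull/rep.
  - by exists v; exact: sub_conv_hull.
  - by apply: conv_hull_Vpp => w [].
  - by eexists; split; last reflexivity; move=> w [].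
apply: (@represents_axioms _ _ _ P) => //.
(* Weights summing to 1 cannot form an empty family, so a nonempty hull has a generator. *)
- apply: contrapT => P0; move: Vv; rewrite VE => -[n [w [f [_ w1 Pf _]]]].
  case: n w f w1 Pf => [|n] w f w1 Pf.
    by move/eqP: w1; rewrite big_ord0 eq_sym oner_eq0.
  by apply: P0; exists (f ord0).
- by move=> w Pw; apply: VV; rewrite VE; exact: sub_conv_hull.
- by apply/represents_conv_hull; rewrite -VE.
Qed.
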